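(* Regular path homology is not invariant with respect to homotopy equivalence of digraphs; that is, there exist finite directed graphs $G$ and $H$ that are homotopy equivalent as digraphs but whose regular path homology groups are not isomorphic.
   Context: $R$ is a fixed nonzero commutative unital ring. A directed graph (digraph) $G$ has vertex set $V(G)$ and edge set $E(G)\subseteq V(G)\times V(G)$, with no loops. Regular path homology: let $\Lambda_n(G)$ be the free $R$-module on all $(n+1)$-tuples of vertices, with $\partial=\sum_{i=0}^n(-1)^i(\text{delete the } i\text{-th entry})$ (and $\partial=0$ for $n=0$). A tuple $(x_0,\dots,x_n)$ is allowed if $(x_i,x_{i+1})\in E(G)$ for all $i$, and strongly regular if its entries are pairwise distinct. Let $\mathcal{A}^\iota_n(G)\subseteq\Lambda_n(G)$ be spanned by the strongly regular allowed tuples, and $\Omega^\iota_n(G)=\{v\in\mathcal{A}^\iota_n(G)\mid \partial v\in\mathcal{A}^\iota_{n-1}(G)\}$ (with $\Omega^\iota_0=\mathcal{A}^\iota_0$). The regular path homology groups are the homology groups of $(\Omega^\iota_*(G),\partial)$. Homotopy of digraphs (in the sense of Grigor'yan–Lin–Muranov–Yau): a digraph map $f\colon G\to H$ is a function $V(G)\to V(H)$ such that for each edge $(x,y)$ of $G$ either $f(x)=f(y)$ or $(f(x),f(y))\in E(H)$. A line digraph $I$ of length $m\ge 0$ has vertices $0,\dots,m$ and, for each $i<m$, exactly one of the edges $(i,i+1)$, $(i+1,i)$, and no other edges. The box product $G\,\square\, I$ has vertex set $V(G)\times V(I)$ and an edge from $(x,i)$ to $(y,j)$ iff either $x=y$ and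 $(i,j)\in E(I)$, or $i=j$ and $(x,y)\in E(G)$. Two digraph maps $f,g\colon G\to H$ are homotopic if there are a line digraph $I$ of some length $m$ and a digraph map $F\colon G\,\square\, I\to H$ with $F(x,0)=f(x)$ and $F(x,m)=g(x)$ for all $x$. Digraphs $G,H$ are homotopy equivalent if there are digraph maps $f\colon G\to H$ and $g\colon H\to G$ with $g\circ f$ and $f\circ g$ homotopic to the respective identities. *)

(* Defs.v *)
From HB Require Import structures.
From mathcomp Require Import all_boot all_algebra.
From mathcomp Require Import boolp zify.

Set Implicit Arguments.
Unset Strict Implicit.
Unset Printing Implicit Defensive.

Import GRing.Theory.
Local Open Scope ring_scope.
Local Open Scope quotient_scope.

(* The cokernel of [f] as a module.  MathComp quotients need a boolean
   predicate, whence the classical [`[< _ >]]. *)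
Section Cokernel.
Variables (R : nzRingType) (U V : lmodType R) (f : {linear U -> V}).

Definition image_pred : pred V := fun v => `[< exists u, f u = v >].

Fact image_pred_zmod_closed : zmod_closed image_pred.
Proof.
split=> [|x y]; first by apply/asboolP; exists 0; rewrite linear0.
move=> /asboolP[u <-] /asboolP[w <-]; apply/asboolP.
by exists (u - w); rewrite linearB.
Qed.
HB.instance Definition _ :=
  GRing.isZmodClosed.Build V image_pred image_pred_zmod_closed.

Definition image_zmod : zmodClosed V := GRing.ZmodClosed.clone V image_pred _.

Definition coker : Type := Quotient.quot image_zmod.

HB.instance Definition _ := GRing.Zmodule.on coker.

Definition coker_proj (v : V) : coker := \pi_(Quotient.quot image_zmod) v.

Definition coker_scale (a : R) (x : coker) : coker :=
  coker_proj (a *: repr (x : Quotient.quot image_zmod)).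

Fact coker_projE (x y : V) :
  coker_proj x = coker_proj y <-> exists u, f u = x - y.
Proof.
split=> [/eqP|e]; last apply/eqP.
  by rewrite -Quotient.idealrBE => /asboolP.
by rewrite -Quotient.idealrBE; apply/asboolP.
Qed.

Fact coker_scale_proj a v : coker_scale a (coker_proj v) = coker_proj (a *: v).
Proof.
apply/coker_projE.
have /coker_projE[u fu] : coker_proj (repr (coker_proj v : Quotient.quot image_zmod))
    = coker_proj v by rewrite /coker_proj reprK.
by exists (a *: u); rewrite linearZ /= fu scalerBr.
Qed.

Fact coker_projD u v : coker_proj (u + v) = coker_proj u + coker_proj v.
Proof. by rewrite /coker_proj raddfD. Qed.

Fact coker_proj_surj (x : coker) : exists v, x = coker_proj v.
Proof. by exists (repr (x : Quotient.quot image_zmod)); rewrite /coker_proj reprK. Qed.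

Fact coker_scaleA a b x :
  coker_scale a (coker_scale b x) = coker_scale (a * b) x.
Proof.
by have [v ->] := coker_proj_surj x; rewrite !coker_scale_proj scalerA.
Qed.

Fact coker_scale1 : left_id 1 coker_scale.
Proof.
by move=> x; have [v ->] := coker_proj_surj x; rewrite coker_scale_proj scale1r.
Qed.

Fact coker_scaleDr : right_distributive coker_scale +%R.
Proof.
move=> a x y; have [v ->] := coker_proj_surj x.
have [w ->] := coker_proj_surj y.
by rewrite -coker_projD !coker_scale_proj scalerDr coker_projD.
Qed.

Fact coker_scaleDl x : {morph coker_scale^~ x : a b / a + b}.
Proof.
move=> a b; have [v ->] := coker_proj_surj x.
by rewrite !coker_scale_proj scalerDl coker_projD.
Qed.

HB.instance Definition _ := GRing.Zmodule_isLmodule.Build R coker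
  coker_scaleA coker_scale1 coker_scaleDr coker_scaleDl.

Fact coker_proj_linear : linear coker_proj.
Proof. by move=> a u v; rewrite coker_projD -coker_scale_proj. Qed.
HB.instance Definition _ :=
  GRing.isLinear.Build R V coker _ coker_proj coker_proj_linear.

End Cokernel.

(* [dif n] is the differential from degree [n.+1] to degree [n]; the
   differential out of degree 0 is zero. *)
Record chain_complex (R : nzRingType) := ChainComplex {
  obj : nat -> lmodType R;
  dif : forall n, {linear obj n.+1 -> obj n};
  dif_dif : forall n x, dif n (dif n.+1 x) = 0
}.

Section Homology.
Variables (R : nzRingType) (C : chain_complex R).

Definition cycle_pred n : pred (obj C n) :=
  match n return pred (obj C n) with
  | 0 => xpredT
  | m.+1 => fun x => dif C m x == 0
  end.

Fact cycle_submod_closed n : submod_closed (@cycle_pred n).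
Proof.
case: n => [|n]; split=> //; first by rewrite unfold_in /= linear0.
move=> a x y; rewrite !unfold_in /= => /eqP dx /eqP dy.
by rewrite linearP dx dy scaler0 addr0.
Qed.
HB.instance Definition _ n :=
  GRing.isSubmodClosed.Build R (obj C n) (@cycle_pred n)
    (cycle_submod_closed n).

Record cycles n := Cycle {
  cycle_val : obj C n;
  _ : cycle_val \in @cycle_pred n
}.
HB.instance Definition _ n := [isSub for @cycle_val n].
HB.instance Definition _ n := [Choice of cycles n by <:].
HB.instance Definition _ n := [SubChoice_isSubLmodule of cycles n by <:].

Fact dif_cycle n (x : obj C n.+1) : dif C n x \in @cycle_pred n.
Proof. by case: n x => // n x; rewrite unfold_in /= dif_dif. Qed.

Definition boundary n (x : obj C n.+1) : cycles n := Cycle (dif_cycle x).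

Fact boundary_linear n : linear (@boundary n).
Proof. by move=> a x y; apply: val_inj; rewrite /= linearP. Qed.
HB.instance Definition _ n :=
  GRing.isLinear.Build R (obj C n.+1) (cycles n) _ (@boundary n)
    (@boundary_linear n).

Definition homology n : lmodType R := coker (@boundary n).

End Homology.

Definition lmod_isomorphic (R : nzRingType) (M N : lmodType R) : Prop :=
  exists f : {linear M -> N}, bijective f.

Record digraph := Digraph {
  vertex : finType;
  edge : rel vertex;
  edge_irr : irreflexive edge
}.

Definition digraph_map (G H : digraph) (f : vertex G -> vertex H) : Prop :=
  forall x y, edge x y -> f x = f y \/ edge (f x) (f y).

(* The line digraph of length [m]: the edge between [i] and [i + 1] is
   [(i, i + 1)] if [s i], and [(i + 1, i)] otherwise; only the values of [s]
   below [m] matter. *)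
Definition line_edge m (s : pred nat) : rel 'I_m.+1 := fun i j =>
  ((j == i.+1 :> nat) && s i) || ((i == j.+1 :> nat) && ~~ s j).

Fact line_edge_irr m s : irreflexive (@line_edge m s).
Proof. by move=> i; rewrite /line_edge !ltn_eqF. Qed.

Definition line_digraph m s : digraph := Digraph (@line_edge_irr m s).

Section BoxProduct.
Variables G H : digraph.

Definition box_edge : rel (vertex G * vertex H) := fun p q =>
  ((p.1 == q.1) && edge p.2 q.2) || ((p.2 == q.2) && edge p.1 q.1).

Fact box_edge_irr : irreflexive box_edge.
Proof. by move=> p; rewrite /box_edge !edge_irr !andbF. Qed.

Definition box : digraph := Digraph box_edge_irr.

End BoxProduct.

Definition homotopic (G H : digraph) (f g : vertex G -> vertex H) : Prop :=
  exists m (s : pred nat) (F : vertex (box G (line_digraph m s)) -> vertex H),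
    [/\ digraph_map F,
        forall x, F (x, ord0) = f x
      & forall x, F (x, ord_max) = g x].

Definition homotopy_equivalent (G H : digraph) : Prop :=
  exists (f : vertex G -> vertex H) (g : vertex H -> vertex G),
    [/\ digraph_map f, digraph_map g, homotopic (g \o f) id
      & homotopic (f \o g) id].

Section PathHomology.
Variables (R : comNzRingType) (G : digraph).

(* The free module on (n+1)-tuples of vertices: since there are finitely many,
   a chain is its family of coefficients. *)
Definition chain n : lmodType R := {ffun n.+1.-tuple (vertex G) -> R^o}.

Definition basis_chain n (t : n.+1.-tuple (vertex G)) : chain n :=
  [ffun u => (u == t)%:R].

Definition face n (i : 'I_n.+2) (t : n.+2.-tuple (vertex G)) :
    n.+1.-tuple (vertex G) :=
  [tuple tnth t (lift i j) | j < n.+1].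

Definition path_dif n (v : chain n.+1) : chain n :=
  \sum_t (v t : R) *: \sum_(i < n.+2) (-1) ^+ i *: basis_chain (face i t).

Definition allowed n (t : n.+1.-tuple (vertex G)) : bool :=
  [forall i : 'I_n, edge (tnth t (widen_ord (leqnSn n) i)) (tnth t (lift ord0 i))].

Definition strongly_regular n (t : n.+1.-tuple (vertex G)) : bool := uniq t.

Definition allowed_chain n : pred (chain n) := fun v =>
  [forall t, (v t != 0) ==> allowed t && strongly_regular t].

Definition omega_pred n : pred (chain n) :=
  match n return pred (chain n) with
  | 0 => fun v => allowed_chain v
  | m.+1 => fun v => allowed_chain v && allowed_chain (path_dif v)
  end.

Fact chainE n (v : chain n) : v = \sum_t (v t : R) *: basis_chain t.
Proof.
apply/ffunP => u; rewrite sum_ffunE (bigD1 u) //= big1 => [|t tu].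
  by rewrite addr0 !ffunE eqxx [RHS]mulr1.
by rewrite !ffunE eq_sym (negPf tu) scaler0.
Qed.

Fact allowed_chainP n (v : chain n) :
  reflect (exists c : n.+1.-tuple (vertex G) -> R,
             v = \sum_(t | allowed t && strongly_regular t) c t *: basis_chain t)
          (allowed_chain v).
Proof.
apply: (iffP forallP) => [Av | [c ->] t].
  exists v; rewrite {1}[v]chainE [RHS]big_mkcond /=; apply: eq_bigr => t _.
  case: ifP => // /negP At; have /implyP := Av t.
  by case: eqP => [-> _|_ /(_ isT)/At//]; rewrite scale0r.
apply/implyP; apply: contraR => At; rewrite sum_ffunE big1 // => u Au.
rewrite !ffunE; case: eqP => [tu|_]; last by rewrite scaler0.
by rewrite tu Au in At.
Qed.

Fact path_dif_linear n : linear (@path_dif n).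
Proof.
move=> a v w; rewrite /path_dif scaler_sumr -big_split /=.
by apply: eq_bigr => t _; rewrite !ffunE scalerDl scalerA.
Qed.
HB.instance Definition _ n :=
  GRing.isLinear.Build R (chain n.+1) (chain n) _ (@path_dif n)
    (@path_dif_linear n).

Fact path_dif_basis n (t : n.+2.-tuple (vertex G)) :
  path_dif (basis_chain t) =
  \sum_(i < n.+2) (-1) ^+ i *: basis_chain (face i t).
Proof.
rewrite /path_dif (bigD1 t) //= [X in _ + X]big1 => [|u ut].
  by rewrite ffunE eqxx scale1r addr0.
by rewrite ffunE (negPf ut) scale0r.
Qed.

Fact face_face n (t : n.+3.-tuple (vertex G)) (i i' : 'I_n.+3) (j j' : 'I_n.+2) :
  (j < i)%N -> i' = j :> nat -> j' = i.-1 :> nat ->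
  face j (face i t) = face j' (face i' t).
Proof.
move=> ji ei ej; apply: eq_from_tnth => k; rewrite !tnth_mktuple; congr tnth.
apply: val_inj; rewrite /= ei ej /bump; lia.
Qed.

Fact path_dif_dif n (v : chain n.+2) : path_dif (path_dif v) = 0.
Proof.
rewrite [path_dif v]/path_dif linear_sum big1 //= => t _.
rewrite linearZ linear_sum /=.
pose S (p : 'I_n.+3 * 'I_n.+2) : chain n :=
  (-1) ^+ (p.1 + p.2)%N *: basis_chain (face p.2 (face p.1 t)).
have -> : \sum_(i < n.+3)
    path_dif ((-1) ^+ i *: basis_chain (face i t)) = \sum_p S p.
  rewrite -(pair_bigA _ (fun i j => S (i, j))) /=; apply: eq_bigr => i _.
  rewrite linearZ /= path_dif_basis scaler_sumr; apply: eq_bigr => j _.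
  by rewrite scalerA -exprD.
rewrite (bigID (fun p : 'I_n.+3 * 'I_n.+2 => (p.2 < p.1)%N)) /=.
rewrite [X in _ + X](reindex_onto
  (fun p : 'I_n.+3 * 'I_n.+2 => (inord p.2, inord p.1.-1) : 'I_n.+3 * 'I_n.+2)
  (fun p : 'I_n.+3 * 'I_n.+2 => (inord p.2.+1, inord p.1))) /=; last first.
  case=> i j /=; rewrite -leqNgt => ij; congr pair; apply: val_inj => /=.
    by rewrite (@inordK _ i) ?inordK // (leq_ltn_trans ij).
  have jl : (j.+1 < n.+3)%N := ltn_ord j.
  by rewrite (inordK jl) /= inordK.
rewrite [X in _ + X](eq_bigl (fun p : 'I_n.+3 * 'I_n.+2 => (p.2 < p.1)%N)); last first.
  case=> i j /=; have jl : (j < n.+3)%N by rewrite ltnW // ltnS.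
  have il : (i.-1 < n.+2)%N by case: i => [[|i] ?].
  rewrite xpair_eqE -!(inj_eq val_inj) /= (inordK il) (inordK jl) -leqNgt.
  rewrite (inordK (ltn_ord j)) eqxx andbT; case: i il => [[|i] ilt] /= il.
    by rewrite inordK // andbF.
  by rewrite inordK // eqxx andbT.
rewrite -big_split big1 ?scaler0 //= => [[i j]] /= ji; rewrite /S /=.
have jl : (j < n.+3)%N by rewrite ltnW // ltnS.
have il : (i.-1 < n.+2)%N by case: i {ji} => [[|i] ?].
rewrite (@face_face _ t i (inord j) j (inord i.-1)) ?inordK //.
rewrite -scalerDl; case: i ji il => [[|i] ?] //= ji il.
by rewrite addSn exprS mulN1r addnC addNr scale0r.
Qed.

Fact omega_submod_closed n : submod_closed (@omega_pred n).
Proof.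
have A0 m : allowed_chain (0 : chain m).
  by apply/forallP => t; rewrite ffunE eqxx.
have AP m a (x y : chain m) :
    allowed_chain x -> allowed_chain y -> allowed_chain (a *: x + y).
  move=> /forallP Ax /forallP Ay; apply/forallP => t; rewrite !ffunE.
  apply/implyP => nz; move: (Ax t) (Ay t).
  case: (eqVneq (x t) 0) nz => [->|_ _ /implyP-> //].
  by rewrite scaler0 add0r => nz _ /implyP->.
case: n => [|n]; split => [|a x y]; [exact: A0 | exact: AP | |].
  by rewrite unfold_in /= linear0 !A0.
by rewrite !unfold_in /= => /andP[? ?] /andP[? ?]; rewrite linearP !AP.
Qed.
HB.instance Definition _ n :=
  GRing.isSubmodClosed.Build R (chain n) (@omega_pred n)
    (omega_submod_closed n).

Record omega n := Omega {
  omega_val : chain n;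
  _ : omega_val \in @omega_pred n
}.
HB.instance Definition _ n := [isSub for @omega_val n].
HB.instance Definition _ n := [Choice of omega n by <:].
HB.instance Definition _ n := [SubChoice_isSubLmodule of omega n by <:].

Fact omega_dif_subproof n (x : omega n.+1) :
  path_dif (omega_val x) \in @omega_pred n.
Proof.
case: x => x /= /andP[_ Adx]; case: n x Adx => [|n] x Adx //.
rewrite unfold_in /= Adx path_dif_dif.
by apply/forallP => t; rewrite ffunE eqxx.
Qed.

Definition omega_dif n (x : omega n.+1) : omega n :=
  Omega (omega_dif_subproof x).

Fact omega_dif_linear n : linear (@omega_dif n).
Proof. by move=> a x y; apply: val_inj; rewrite /= linearP. Qed.
HB.instance Definition _ n :=
  GRing.isLinear.Build R (omega n.+1) (omega n) _ (@omega_dif n)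
    (@omega_dif_linear n).

Fact omega_dif_dif n (x : omega n.+2) : omega_dif (omega_dif x) = 0.
Proof. by apply: val_inj; rewrite /= path_dif_dif. Qed.

Definition omega_complex : chain_complex R :=
  @ChainComplex R (fun n => omega n : lmodType R)
    (fun n => @omega_dif n : {linear omega n.+1 -> omega n}) omega_dif_dif.

Definition path_homology n : lmodType R := homology omega_complex n.

End PathHomology.

(* Main.v *)
(* Any map into a complete digraph is a digraph map, so all nonempty complete
   digraphs are homotopy equivalent; in particular the double edge [a <-> b] is
   contractible.  But [(a, b) + (b, a)] is a cycle on the double edge, and it is
   not a boundary because two vertices carry no strongly regular triple: the
   path [(a, b, a)] that would fill it repeats [a]. *)

Require Import Defs.
From mathcomp Require Import all_boot all_algebra.

Set Implicit Arguments.
Unset Strict Implicit.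
Unset Printing Implicit Defensive.

Import GRing.Theory.
Local Open Scope ring_scope.

Section CompleteDigraph.
Variable T : finType.

Fact complete_edge_irr : irreflexive (fun x y : T => x != y).
Proof. by move=> x; rewrite eqxx. Qed.

Definition complete_digraph : digraph := Digraph complete_edge_irr.

Lemma complete_digraph_map (G : digraph) (f : vertex G -> T) :
  digraph_map (H := complete_digraph) f.
Proof. by move=> x y _; have [|] := eqVneq (f x) (f y); [left | right]. Qed.

Lemma complete_homotopic (G : digraph) (f g : vertex G -> T) :
  homotopic (H := complete_digraph) f g.
Proof.
(* A line of length one suffices, with [f] at one end and [g] at the other: completeness of the
   target imposes no compatibility, so the orientation [xpredT] is an arbitrary choice. *)
exists 1%N, xpredT, (fun p => if p.2 == ord0 then f p.1 else g p.1).
by split=> //; apply: complete_digraph_map.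
Qed.

End CompleteDigraph.

Lemma complete_homotopy_equivalent (S T : finType) (x : S) (y : T) :
  homotopy_equivalent (complete_digraph S) (complete_digraph T).
Proof.
exists (fun=> y), (fun=> x).
by split; [exact: complete_digraph_map .. | |]; apply: complete_homotopic.
Qed.

Section PathHomologyFacts.
Variables (R : comNzRingType) (G : digraph).

Lemma edge_neq (x y : vertex G) : edge x y -> x != y.
Proof. by apply: contraTneq => ->; rewrite edge_irr. Qed.

Lemma omega_allowed n (x : omega R G n) : allowed_chain (omega_val x).
Proof. by case: n x => [|n] [x] //= /andP[]. Qed.

(** Pigeonhole: a strongly regular tuple in degree [n] needs [n + 1] distinct vertices, so every
    coefficient of [x] vanishes. *)
Lemma omega_eq0 n (x : omega R G n) : (#|vertex G| <= n)%N -> x = 0.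
Proof.
move=> cardG; apply/val_inj/ffunP => t; rewrite /= ffunE; apply/eqP.
have /forallP/(_ t) := omega_allowed x; apply: contraLR => ->.
rewrite /= negb_and orbC /strongly_regular; apply/orP; left.
by apply: contraL cardG => /card_uniqP ut; rewrite -ltnNge -(size_tuple t) -ut max_card.
Qed.

(** A single vertex has no consecutive pair to test and no repetition. Hence the boundary condition
    defining [omega] in degree 1 is automatic. *)
Lemma allowed_chain0 (v : chain R G 0) : allowed_chain v.
Proof.
apply/forallP => t; apply/implyP => _; apply/andP; split.
  by apply/forallP; case.
by case/tupleP: t => x t; rewrite tuple0.
Qed.

Lemma path_homology_eq0 n (h : path_homology R G n) :
  (#|vertex G| <= n)%N -> h = 0.
Proof.
move=> cardG; have [v ->] := coker_proj_surj h.
rewrite -[RHS](linear0 (coker_proj (@boundary R (omega_complex R G) n))).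
by congr coker_proj; apply: val_inj; rewrite /= [LHS]omega_eq0 // [RHS]omega_eq0.
Qed.

Lemma path_dif_edge (x y : vertex G) :
  path_dif (basis_chain R [tuple x; y]) =
  basis_chain R [tuple y] - basis_chain R [tuple x].
Proof.
rewrite path_dif_basis 2!big_ord_recl big_ord0 addr0 expr0 expr1 scale1r scaleN1r.
by congr (basis_chain R _ - basis_chain R _); apply: eq_from_tnth => i;
  rewrite tnth_mktuple (ord1 i).
Qed.

Lemma allowed_edge (x y : vertex G) :
  edge x y -> allowed [tuple x; y] && strongly_regular [tuple x; y].
Proof.
move=> xy; apply/andP; split; first by apply/forallP => i; rewrite ord1.
by rewrite /strongly_regular /= inE andbT edge_neq.
Qed.

Definition double_edge_chain (x y : vertex G) : chain R G 1 :=
  basis_chain R [tuple x; y] + basis_chain R [tuple y; x].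

Lemma path_dif_double_edge (x y : vertex G) :
  path_dif (double_edge_chain x y) = 0.
Proof. by rewrite linearD /= !path_dif_edge addrC subrKA subrr. Qed.

Lemma double_edge_omega (x y : vertex G) :
  edge x y -> edge y x -> double_edge_chain x y \in @omega_pred R G 1.
Proof.
move=> xy yx; rewrite unfold_in /= allowed_chain0 andbT.
apply/forallP => t; apply/implyP; rewrite !ffunE.
have [-> _|_] := eqVneq t [tuple x; y]; first exact: allowed_edge.
have [-> _|_] := eqVneq t [tuple y; x]; first exact: allowed_edge.
by rewrite addr0 eqxx.
Qed.

(** The two-edge cycle survives because [omega] is zero in degree 2 on at most two vertices, leaving
    only the zero boundary in degree 1. *)
Lemma path_homology_double_edge (x y : vertex G) :
  edge x y -> edge y x -> (#|vertex G| <= 2)%N ->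
  exists h : path_homology R G 1, h <> 0.
Proof.
move=> xy yx cardG; pose z := Omega (double_edge_omega xy yx).
have zP : z \in @cycle_pred R (omega_complex R G) 1.
  by rewrite unfold_in; apply/eqP/val_inj; exact: path_dif_double_edge.
pose p := coker_proj (@boundary R (omega_complex R G) 1).
exists (p (Cycle zP)); rewrite -(linear0 p) => /coker_projE[u].
(* The chain [u] bounding the cycle lies in degree 2, so it is zero, and then so is the cycle
   itself. *)
rewrite (omega_eq0 u cardG) subr0 linear0 => /(congr1 val)/(congr1 val) /=.
(* The coefficient at [(x, y)] is 1, since [(y, x)] is a different tuple; this contradicts [1 != 0]
   in [R]. *)
move/ffunP/(_ [tuple x; y]); rewrite !ffunE eqxx -val_eqE /= eqseq_cons.
by rewrite (negPf (edge_neq xy)) addr0 => /esym/eqP; rewrite oner_eq0.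
Qed.

End PathHomologyFacts.

Theorem corollary5p20 (R : comNzRingType) :
  exists G H : digraph,
    homotopy_equivalent G H /\
    exists n : nat,
      ~ lmod_isomorphic (path_homology R G n) (path_homology R H n).
Proof.
(* The double edge and the one-point digraph, to be told apart in degree 1. *)
exists (complete_digraph bool), (complete_digraph unit); split.
  exact: complete_homotopy_equivalent true tt.
exists 1%N => -[f /bij_inj f_inj].
have [||| h] := @path_homology_double_edge R (complete_digraph bool) true false.
- by [].
- by [].
- by rewrite card_bool.
(* The homology of the point vanishes in degree 1, so [f] sends the nonzero class [h] to 0, against
   injectivity. *)
apply; apply: f_inj; rewrite [RHS]linear0.
by apply: path_homology_eq0; rewrite card_unit.
Qed.
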